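(* Let $G$ be a finite simple connected graph with maximum edge weight $W(G)\le 7$. If $mad(G)<\frac{40}{13}$, then $\chi_s'(G)\le 13$.
   Context: All graphs are finite, simple and connected. For a graph $G$, $d(u)$ denotes the degree of the vertex $u$. The maximum edge weight of $G$ is $W(G)=\max\{d(u)+d(v):\ uv\in E(G)\}$. The maximum average degree of $G$ is $mad(G)=\max\{\bar d(G'):\ G'\subseteq G\}$, the maximum being over all (nonempty, not necessarily connected) subgraphs $G'$ of $G$, where $\bar d(G')=\frac{2|E(G')|}{|V(G')|}$ is the average degree of $G'$. The distance between two edges of $G$ is the distance between the corresponding vertices in the line graph of $G$ (so two distinct edges sharing an endpoint are at distance $1$, and two edges that share no endpoint but are joined by another edge are at distance $2$). A strong edge-coloring of $G$ is an assignment of colors to the edges of $G$ such that any two distinct edges at distance at most two receive distinct colors. The strong chromatic index $\chi_s'(G)$ is the minimum number of colors in a strong edge-coloring of $G$. *)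

(* Defs.v *)
From mathcomp Require Import all_boot all_order all_algebra.

Set Implicit Arguments.
Unset Strict Implicit.
Unset Printing Implicit Defensive.

Record sgraph := SGraph {
  vertex :> finType;
  adj : rel vertex;
  adj_sym : symmetric adj;
  adj_irr : irreflexive adj }.

Section Graph.
Variable G : sgraph.

Definition connected : bool :=
  (0 < #|G|) && [forall x : G, forall y : G, connect (@adj G) x y].

Definition degree (x : G) : nat := #|[set y | adj x y]|.

(* Edges are two-element vertex sets [set x; y]. *)
Definition edges : {set {set G}} :=
  [set [set p.1; p.2] | p : G * G & adj p.1 p.2].

Definition edge : finType := {f : {set G} | f \in edges}.

Definition max_edge_weight : nat :=
  \max_(p : G * G | adj p.1 p.2) (degree p.1 + degree p.2).

(* A candidate subgraph is a pair (vertex set, edge set); it need be neither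
   induced nor connected. *)
Definition is_subgraph (H : {set G} * {set {set G}}) : bool :=
  (H.2 \subset edges) && [forall f in H.2, f \subset H.1].

Definition avg_degree (H : {set G} * {set {set G}}) : rat :=
  ((2 * #|H.2|)%:R / #|H.1|%:R)%R.

(* Average degrees are nonnegative, so the default value 0 does not affect the
   maximum. *)
Definition mad : rat :=
  \big[Num.max/0%R]_(H : {set G} * {set {set G}} |
      is_subgraph H && (H.1 != set0)) avg_degree H.

Definition walk (k : nat) (x y : G) : bool :=
  [exists p : k.-tuple G, path (@adj G) x p && (last x p == y)].

(* The least length of a walk from x to y, and None if there is no walk; a
   shortest walk repeats no vertex, so it has fewer than #|G| steps. *)
Definition dist (x y : G) : option nat :=
  ohead [seq k <- iota 0 #|G| | walk k x y].

Definition dist_at_most (d : nat) (x y : G) : bool :=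
  if dist x y is Some k then k <= d else false.

Definition line_adj (f g : edge) : bool :=
  (f != g) && (val f :&: val g != set0).

Lemma line_adj_sym : symmetric line_adj.
Proof. by move=> f g; rewrite /line_adj eq_sym setIC. Qed.

Lemma line_adj_irr : irreflexive line_adj.
Proof. by move=> f; rewrite /line_adj eqxx. Qed.

End Graph.

Definition line_graph (G : sgraph) : sgraph :=
  SGraph (@line_adj_sym G) (@line_adj_irr G).

Section StrongColoring.
Variable G : sgraph.

Definition strong_edge_coloring (k : nat) (c : {ffun edge G -> 'I_k}) : bool :=
  [forall f : line_graph G, forall g : line_graph G,
     (f != g) && dist_at_most 2 f g ==> (c f != c g)].

Definition strong_edge_colorable (k : nat) : bool :=
  [exists c : {ffun edge G -> 'I_k}, strong_edge_coloring c].

Lemma strong_edge_colorable_ex : exists k, strong_edge_colorable k.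
Proof.
exists #|edge G|; apply/existsP; exists [ffun f => enum_rank f].
apply/forallP=> f; apply/forallP=> g; apply/implyP=> /andP[neq_fg _].
by rewrite !ffunE (inj_eq enum_rank_inj).
Qed.

Definition strong_chromatic_index : nat := ex_minn strong_edge_colorable_ex.

End StrongColoring.

(* Main.v *)
(* Take a graph with edge weight at most 7 that is not 13-colorable although
   deleting any non-isolated vertex makes it so. Counting the edges at distance
   at most two and coloring greedily, its degrees are between 2 and 5, and
   2-vertices only have neighbors of degree 4 or 5. A 5-vertex u has
   only 2-neighbors v, each with one further edge vw. A coloring of G - u extends
   to u unless these five edges have distinct ends w and distinct colors; but then
   each of them can be recolored with at least 4 of the 13 colors, so two of them
   can be given the same color, and the new coloring extends. Hence all degrees are 2, 3 or 4;
   a 2-vertex has two 4-neighbors, a 4-vertex at most one 2-neighbor, and a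
   3-vertex without 4-neighbor sees at least three 4-vertices, with
   multiplicity, at distance two.

   Discharging: every 4-vertex gives 7/13 to its 2-neighbor and 5/39 to each
   3-neighbor, and a 3-vertex with n 4-neighbors passes n/39 on to each
   3-neighbor. Every vertex ends with at least 40/13, so the average degree is
   at least 40/13. *)
Require Import Defs.
From Stdlib Require Import Classical_Prop.
From mathcomp Require Import all_boot all_order all_algebra.
From mathcomp Require Import zify.

Set Implicit Arguments.
Unset Strict Implicit.
Unset Printing Implicit Defensive.

(** * Union bound and greedy choice of distinct representatives *)

Lemma card_bigcup_leq (I K : finType) (A : {set I}) (F : I -> {set K}) :
  #|\bigcup_(i in A) F i| <= \sum_(i in A) #|F i|.
Proof.
elim/big_ind2: _ => [|? m ? n le_m le_n|//]; first by rewrite cards0.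
by apply: leq_trans (leq_add le_m le_n); rewrite cardsU leq_subr.
Qed.

(** Representatives are picked in the order of [s]: at position i at most i colors are taken, so a
    list of more than i colors still offers one. *)
Lemma greedy_sdr (T : eqType) (K : finType) (k0 : K) (L : T -> {set K}) (x0 : T)
    (s : seq T) :
  uniq s -> (forall i, i < size s -> i < #|L (nth x0 s i)|) ->
  exists f : T -> K, {in s &, injective f} /\ {in s, forall x, f x \in L x}.
Proof.
elim/last_ind: s => [|s x IHs]; first by exists (fun=> k0).
rewrite rcons_uniq size_rcons => /andP[x_s uniq_s] Ls.
have [|f [f_inj fL]] := IHs uniq_s.
  by move=> i lt_i; have := Ls i (leqW lt_i); rewrite nth_rcons lt_i.
have /subsetPn[k kL kNf] : ~~ (L x \subset [set:: map f s]).
  apply: contraL (Ls _ (ltnSn (size s))) => /subset_leq_card le_L.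
  rewrite nth_rcons ltnn eqxx -leqNgt (leq_trans le_L) //.
  by rewrite cardsE (leq_trans (card_size _)) ?size_map.
rewrite inE in kNf.
exists (fun y => if y == x then k else f y); split=> [y z|y];
  rewrite !mem_rcons !inE.
  case: eqVneq => [->|_] /= ys; case: eqVneq => [->|_] //= zs.
  - by move=> kf; rewrite kf map_f in kNf.
  - by move=> kf; rewrite -kf map_f in kNf.
  - exact: f_inj.
by case: eqVneq => [->|_] //= /fL.
Qed.

(** * Strong colorings: extension to a deleted vertex and recoloring of an edge *)

Section Relation.

Variables T K : finType.
Hypothesis cardK : #|K| = 13.
Implicit Types (e : rel T) (c : T -> T -> K) (v x y z w : T).

Definition nbr e x : {set T} := [set y | e x y].
Definition deg e x := #|nbr e x|.
(** The vertex stays in [T] and becomes isolated, so colorings before and after a deletion have the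
    same type. *)
Definition del_vertex e v : rel T := [rel x y | [&& e x y, x != v & y != v]].

(* Two distinct edges are at distance at most two exactly when they are both
   edges of one nonbacktracking walk of length two or three. *)
Definition strong e c :=
  [/\ forall x y, c x y = c y x,
      forall x y z, e x y -> e x z -> y != z -> c x y != c x z
    & forall x y z w, e x y -> e x z -> e z w -> y != z -> x != w ->
        c x y != c z w].

Definition colors_at e c v x : {set K} := [set c x y | y in nbr e x :\ v].

(** The colors that the edge uv sees while all edges at v are uncolored. The other edges at u are
    counted in the first union, at their far ends x. *)
Definition forb e c v u : {set K} :=
  (\bigcup_(x in nbr e u :\ v) colors_at e c v x)
    :|: \bigcup_(x in nbr e v :\ u) colors_at e c v x.

Lemma colors_at_leq e c v x : #|colors_at e c v x| <= deg e x.
Proof. exact: leq_trans (leq_imset_card _ _) (subset_leq_card (subsetDl _ _)). Qed.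

Lemma colors_at_ltn e c v x : e x v -> #|colors_at e c v x| <= (deg e x).-1.
Proof.
move=> xv; apply: leq_trans (leq_imset_card _ _) _.
by rewrite /deg [in leqRHS](cardsD1 v) inE xv.
Qed.

Lemma forb_leq e c v u : symmetric e ->
  #|forb e c v u| <=
    \sum_(x in nbr e u :\ v) deg e x + \sum_(x in nbr e v :\ u) (deg e x).-1.
Proof.
move=> e_sym; apply: leq_trans (leq_card_setU _ _) _.
apply: leq_add; apply: leq_trans (card_bigcup_leq _ _) _; apply: leq_sum => x.
  by rewrite colors_at_leq.
by rewrite !inE e_sym => /andP[_]; apply: colors_at_ltn.
Qed.

(** The edges at v need pairwise distinct colors. Colored in the order of [s], the i-th one avoids
    its forbidden colors and the i colors just given. *)
Lemma extend e c v (s : seq T) : symmetric e -> irreflexive e ->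
    strong (del_vertex e v) c -> uniq s -> s =i nbr e v ->
    (forall i, i < size s -> #|forb e c v (nth v s i)| + i < 13) ->
  exists c', strong e c'.
Proof.
move=> e_sym e_irr [c_sym c_prop c_dist] s_uniq s_nbr s_forb.
have /card_gt0P[k0 _] : 0 < #|K| by rewrite cardK.
have [|f [f_inj fL]] :=
  greedy_sdr k0 (L := (fun u => ~: forb e c v u)) (x0 := v) s_uniq.
  by move=> i /s_forb; have := cardsC (forb e c v (nth v s i)); rewrite cardK /=; lia.
have eNv x y : e x y -> (x == y) = false.
  by apply: contraTF => /eqP->; rewrite e_irr.
have f_inj' y z : e v y -> e v z -> y != z -> f y != f z.
  by move=> vy vz; apply: contra_neq; apply: f_inj; rewrite s_nbr inE.
(* An old edge in conflict with vu has an end x adjacent to u, or adjacent to v and other than u. *)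
have f_near u x w : e v u -> e x w -> x != v -> w != v ->
    (e u x || (e v x && (x != u))) -> f u != c x w.
  move=> vu xw xv wv ux; have /fL : u \in s by rewrite s_nbr inE.
  rewrite inE; apply: contraNneq => fu; rewrite inE.
  have cw : f u \in colors_at e c v x.
    by rewrite fu; apply/imsetP; exists w; rewrite // !inE wv.
  case/orP: ux => [ux|/andP[vx xu]]; apply/orP; [left|right];
    by apply/bigcupP; exists x; rewrite // !inE ?xv ?xu.
pose c' x y := if x == v then f y else if y == v then f x else c x y.
exists c'; split=> [x y|x y z|x y z w]; rewrite /c'.
- by case: (x =P v) => [->|_]; case: (y =P v) => [yv|_] //; rewrite ?yv // c_sym.
- move=> xy xz yz; case: (x =P v) xy xz => [-> vy vz|/eqP xv xy xz]; first exact: f_inj'.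
  case: (y =P v) yz xy => [-> yz xv'|/eqP yv yz xy].
    rewrite eq_sym in yz; rewrite (negPf yz) c_sym.
    rewrite e_sym in xv'.
    by apply: f_near; rewrite ?xz // e_sym.
  case: (z =P v) yz xz => [-> _ xv'|/eqP zv yz xz].
    rewrite eq_sym c_sym; rewrite e_sym in xv'.
    by apply: f_near; rewrite ?xy // e_sym.
  by apply: c_prop; rewrite // /del_vertex /= ?xy ?xz ?xv ?yv ?zv.
move=> xy xz zw yz xw.
case: (x =P v) xy xz xw => [-> vy vz vw|/eqP xv xy xz xw].
  have zv : z != v by rewrite eq_sym (eNv _ _ vz).
  rewrite eq_sym in vw; rewrite (negPf zv) (negPf vw).
  by apply: f_near; rewrite // vz eq_sym yz orbT.
case: (z =P v) zw xz yz => [-> vw xv' yv|/eqP zv zw xz yz].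
  rewrite e_sym in xv'.
  by rewrite (negPf yv) eq_sym; apply: f_near; rewrite // xv' xw orbT.
case: (y =P v) xy yz => [-> xv' _|/eqP yv xy yz].
  rewrite e_sym in xv'.
  case: (w =P v) zw xw => [-> zv' _|/eqP wv zw xw].
    by apply: f_inj'; rewrite // 1?e_sym // (eNv _ _ xz).
  by apply: f_near; rewrite // xz.
case: (w =P v) zw xw => [-> zv' _|/eqP wv zw xw].
  rewrite e_sym in zv'; rewrite e_sym in xz.
  by rewrite eq_sym; apply: f_near; rewrite // xz.
by apply: c_dist; rewrite // /del_vertex /= ?xy ?xz ?zw ?xv ?yv ?zv ?wv.
Qed.

(** Every other edge within distance two of ab has an end outside {a, b} adjacent to a or to b, so
    the hypothesis on [k] covers all conflicts. *)
Lemma recolor e c a b k : symmetric e -> irreflexive e -> strong e c ->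
    (forall x y, e x y -> (e a x && (x != b)) || (e b x && (x != a)) -> c x y != k) ->
  strong e (fun x y =>
    if (x == a) && (y == b) || (x == b) && (y == a) then k else c x y).
Proof.
move=> e_sym e_irr [c_sym c_prop c_dist] ck.
pose ab x y := (x == a) && (y == b) || (x == b) && (y == a).
have eN x y : e x y -> x != y by apply: contraTneq => ->; rewrite e_irr.
have abN x y z w : ab x y -> e x z -> e z w -> y != z -> k != c z w.
  move=> xy xz zw yz; rewrite eq_sym; apply: ck => //; rewrite eq_sym in yz.
  by case/orP: xy => /andP[/eqP <- /eqP <-]; rewrite xz yz ?orbT.
split=> [x y|x y z xy xz yz|x y z w xy xz zw yz xw]; rewrite -/(ab _ _).
- by rewrite /ab orbC ![(y == _) && _]andbC c_sym.
- rewrite -/(ab x y) -/(ab x z).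
  case: ifP => xyab; case: ifP => xzab; last exact: c_prop.
  + move: xyab xzab yz (eN _ _ xy) => /orP[] /andP[/eqP-> /eqP->];
      by case/orP=> /andP[/eqP xx /eqP->]; rewrite ?xx eqxx.
  + by rewrite c_sym; apply: (abN x y); rewrite // e_sym.
  + by rewrite eq_sym c_sym; apply: (abN x z); rewrite 1?eq_sym // e_sym.
rewrite -/(ab x y) -/(ab z w).
case: ifP => xyab; case: ifP => zwab; last exact: c_dist.
- move: xyab zwab yz (eN _ _ xz) => /orP[] /andP[/eqP-> /eqP->];
    by case/orP=> /andP[/eqP-> _]; rewrite eqxx.
- exact: (abN x y).
- by rewrite eq_sym; apply: (abN z w); rewrite 1?eq_sym // e_sym.
Qed.
End Relation.

(** Otherwise each element of [K] lies in at most one of the sets, and exchanging the sums bounds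
    the total by the size of [K]. *)
Lemma common_element (I K : finType) (A : {set I}) (F : I -> {set K}) :
    #|K| < \sum_(i in A) #|F i| ->
  exists i j k, [/\ i \in A, j \in A, i != j, k \in F i & k \in F j].
Proof.
have [k k2 _|noK] := pickP (fun k => 1 < #|[set i in A | k \in F i]|).
  have [i [j [iA jA ij]]] := card_gt1P k2.
  by move: iA jA; rewrite !inE => /andP[iA ik] /andP[jA jk]; exists i, j, k.
rewrite ltnNge => /negP[]; rewrite -sum1_card.
rewrite (eq_bigr (fun i => \sum_(k in F i) 1)) => [|i _]; last by rewrite sum1_card.
rewrite (exchange_big_dep predT) //=; apply: leq_sum => k _.
by rewrite sum1dep_card leqNgt noK.
Qed.

(** * Degrees in a minimal counterexample *)

Section Critical.

Variables (T K : finType) (e : rel T).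
Hypothesis cardK : #|K| = 13.
Hypothesis e_sym : symmetric e.
Hypothesis e_irr : irreflexive e.
Hypothesis e_weight : forall x y, e x y -> deg e x + deg e y <= 7.
Hypothesis e_del : forall v,
  0 < deg e v -> exists c : T -> T -> K, strong (del_vertex e v) c.
Hypothesis e_ncol : ~ exists c : T -> T -> K, strong e c.

(** Contrapositive of [extend]. A configuration is excluded by exhibiting an order of the edges at v
    in which every edge sees at most 12 colors. *)
Lemma irreducible v (c : T -> T -> K) s :
    strong (del_vertex e v) c -> uniq s -> s =i nbr e v ->
  exists2 i, i < size s & 13 <= #|forb e c v (nth v s i)| + i.
Proof.
move=> c_strong s_uniq s_nbr.
case: (boolP [exists i : 'I_(size s), 13 <= #|forb e c v (nth v s i)| + i]).
  by case/existsP=> i ?; exists i.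
move/existsPn=> s_forb; case: e_ncol; apply: (extend cardK e_sym e_irr c_strong s_uniq) => //.
by move=> i i_s; have := s_forb (Ordinal i_s); rewrite -ltnNge.
Qed.

(** By the weight bound, this product bounds the degree sum of all neighbors but one of a vertex of
    degree d. The maximum is at d = 4. *)
Lemma pred_mul_leq9 d : d.-1 * (7 - d) <= 9.
Proof. by do 7![case: d => [//|d]]; rewrite (_ : 7 - _ = 0) ?muln0. Qed.

Lemma deg_gt0 x y : e x y -> 0 < deg e x.
Proof. by move=> xy; apply/card_gt0P; exists y; rewrite inE. Qed.

Lemma nbr_sum_leq v u (B : {set T}) m : e u v -> B \subset nbr e u -> #|B| <= m ->
  \sum_(x in B) deg e x <= m * (7 - deg e u).
Proof.
move=> uv /subsetP Bu Bm; apply: leq_trans (leq_mul Bm (leqnn _)).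
rewrite -sum_nat_const; apply: leq_sum => x /Bu; rewrite inE => /e_weight; lia.
Qed.

Lemma forb_leq_deg (c : T -> T -> K) v u : e v u ->
  #|forb e c v u| <=
    (deg e u).-1 * (7 - deg e u) + \sum_(x in nbr e v :\ u) (deg e x).-1.
Proof.
move=> vu; apply: leq_trans (forb_leq _ _ _ e_sym) _; rewrite leq_add2r.
rewrite e_sym in vu; apply: (nbr_sum_leq vu); first exact: subsetDl.
by rewrite /deg [in leqRHS](cardsD1 v) inE vu.
Qed.

Lemma forb_leq9 (c : T -> T -> K) v u : e v u ->
  #|forb e c v u| <= 9 + \sum_(x in nbr e v :\ u) (deg e x).-1.
Proof.
by move=> /(forb_leq_deg c)/leq_trans-> //; rewrite leq_add2r pred_mul_leq9.
Qed.

(** The only edge at such a vertex would see at most 9 colors. *)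
Lemma deg_neq1 v : deg e v != 1.
Proof.
apply/negP => dv; have [u vE] := cards1P dv.
have vu : e v u by have := set11 u; rewrite -vE inE.
have [c c_strong] := e_del (deg_gt0 vu).
have [||i] := irreducible (s := [:: u]) c_strong; first by [].
  by move=> x; rewrite vE !inE.
case: i => // _ /=; have := forb_leq9 c vu.
rewrite big1 => [|x]; last by rewrite vE !inE; case: eqP.
by lia.
Qed.

Lemma deg_gt1 x y : e x y -> 1 < deg e x.
Proof. by move=> /deg_gt0; have := deg_neq1 x; case: deg => [|[]]. Qed.

Lemma deg_lt6 x y : e x y -> deg e x < 6.
Proof.
move=> xy; have := e_weight xy; rewrite e_sym in xy.
by have := deg_gt1 xy; lia.
Qed.

Lemma other_nbr v a : deg e v = 2 -> e v a ->
  exists b, [/\ b != a, nbr e v = [set a; b] & nbr e v :\ a = [set b]].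
Proof.
move=> dv va; have /eqP/cards1P[b bE] : #|nbr e v :\ a| = 1.
  by move: dv; rewrite /deg (cardsD1 a) inE va; case.
exists b; have := set11 b; rewrite -{1}bE !inE => /andP[ba _]; split=> //.
by rewrite -bE setD1K // inE.
Qed.

Lemma forb_leq_deg2 (c : T -> T -> K) v a b : nbr e v = [set a; b] -> b != a ->
  #|forb e c v a| <= \sum_(x in nbr e a :\ v) deg e x + (deg e b).-1.
Proof.
move=> vE ba; apply: leq_trans (forb_leq _ _ _ e_sym) _; rewrite leq_add2l.
by rewrite vE setU1K ?inE 1?eq_sym // big_set1.
Qed.

(** Let b be the other neighbor of v. If a has degree at most 3, then va sees at most 8 + 4 colors
    and, colored next, vb sees at most 9 + 2 + 1. *)
Lemma two_nbr v a : deg e v = 2 -> e v a -> 3 < deg e a.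
Proof.
move=> dv va; have [b [ba vE vaE]] := other_nbr dv va.
have vb : e v b by have := set22 a b; rewrite -vE inE.
have [c c_strong] := e_del (deg_gt0 va).
rewrite ltnNge; apply/negP => da.
have [||i] := irreducible (s := [:: a; b]) c_strong.
- by rewrite /= inE eq_sym ba.
- by move=> x; rewrite vE !inE.
have := forb_leq_deg c va; rewrite vaE big_set1.
have := forb_leq9 c vb; rewrite vE setUC setU1K ?inE // big_set1.
have av : e a v by rewrite e_sym.
have bv : e b v by rewrite e_sym.
have := (deg_gt1 av, deg_gt1 bv, e_weight va, e_weight vb).
rewrite dv => -[[[a1 b1] wa] wb].
have [->|->] : deg e a = 2 \/ deg e a = 3 by lia.
  by case: i => [|[|i]] /=; lia.
by case: i => [|[|i]] /=; lia.
Qed.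

(** * Exclusion of vertices of degree 5 *)

Section Degree5.

Variable u : T.
Hypothesis du : deg e u = 5.

(** By weight, a neighbor of [u] has degree 2, so for it the pick is unique and the default never
    occurs. *)
Let w v := odflt u [pick x in nbr e v :\ u].

Lemma deg5_nbr v : v \in nbr e u ->
  [/\ deg e v = 2, nbr e v :\ u = [set w v], w v != u & 3 < deg e (w v) < 6].
Proof.
rewrite inE => uv; have vu : e v u by rewrite e_sym.
have dv : deg e v = 2 by have := e_weight uv; have := deg_gt1 vu; lia.
have [b [bu vE vuE]] := other_nbr dv vu.
have wE : w v = b.
  rewrite /w vuE; case: pickP => [x|/(_ b)]; last by rewrite set11.
  by rewrite inE => /eqP.
have vb : e v b by have := set22 u b; rewrite -vE inE.
rewrite wE bu (two_nbr dv vb); split=> //.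
by rewrite e_sym in vb; rewrite (deg_lt6 vb).
Qed.

Lemma deg5_adj v x : v \in nbr e u -> e v x -> x != u -> x = w v.
Proof.
case/deg5_nbr=> _ vE _ _ vx xu; apply/set1P.
by rewrite -vE !inE xu.
Qed.

Lemma adj_w v : v \in nbr e u -> e v (w v) /\ e (w v) v.
Proof.
by case/deg5_nbr=> _ vE _ _; rewrite (e_sym (w v)); have := set11 (w v);
  rewrite -{1}vE !inE => /andP[_ ->].
Qed.

Let S (c : T -> T -> K) := [set c x (w x) | x in nbr e u].

Lemma forb_deg5 c v : strong (del_vertex e u) c -> v \in nbr e u ->
  forb e c u v \subset colors_at e c u (w v) :|: S c.
Proof.
move=> [c_sym _ _] vN; have [_ vE wu _] := deg5_nbr vN; have [_ wv] := adj_w vN.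
rewrite /forb vE big_set1 setUS //; apply/bigcupsP=> x; rewrite !inE => /andP[_ ux].
have xN : x \in nbr e u by rewrite inE.
have [_ xE _ _] := deg5_nbr xN.
by rewrite /colors_at xE imset_set1 sub1set imset_f.
Qed.

(** The edges from [A] to the common vertex [w v] have distinct colors that occur both at [w v] and
    in [S c], so the union loses #|A|. The 5 bounds the degree of [w v]. *)
Lemma card_forb_deg5 c v (A : {set T}) : strong (del_vertex e u) c ->
    v \in nbr e u -> A \subset nbr e u -> {in A, forall x, w x = w v} ->
  #|forb e c u v| + #|A| <= 5 + #|S c|.
Proof.
move=> c_strong vN /subsetP Au Aw.
have [c_sym c_prop _] := c_strong; have [_ _ wu dw] := deg5_nbr vN.
have wA x : x \in A -> del_vertex e u (w v) x.
  move=> xA; have [_] := adj_w (Au x xA); rewrite Aw // /del_vertex /= wu => -> /=.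
  by apply: contraTneq (Au x xA) => ->; rewrite inE e_irr.
have c_inj : {in A &, injective (c (w v))}.
  by move=> x y xA yA; apply: contra_eq => xy; apply: c_prop; rewrite // wA.
have : #|A| <= #|colors_at e c u (w v) :&: S c|.
  rewrite -(card_in_imset c_inj); apply/subset_leq_card/subsetP => _ /imsetP[x xA ->].
  rewrite inE; apply/andP; split; last first.
    by apply/imsetP; exists x; rewrite ?Au // Aw // c_sym.
  apply/imsetP; exists x; rewrite // !inE.
  by have /and3P[-> _ ->] := wA x xA.
have := subset_leq_card (forb_deg5 c_strong vN); rewrite cardsU.
have := colors_at_leq e c u (w v).
have := subset_leq_card (subsetIl (colors_at e c u (w v)) (S c)).
lia.
Qed.

Lemma card_forb1 c v : strong (del_vertex e u) c -> v \in nbr e u ->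
  #|forb e c u v| + 1 <= 5 + #|S c|.
Proof.
move=> c_strong vN; rewrite -[X in _ + X <= _](cards1 v).
by apply: card_forb_deg5; rewrite ?sub1set // => x /set1P->.
Qed.

Lemma card_S_leq c : #|S c| <= 5.
Proof. by rewrite -du leq_imset_card. Qed.

(** With at most four colors in [S c], each edge at [u] sees at most 5 + 4 - 1 old colors and four
    new ones. *)
Lemma card_S_gt4 c : strong (del_vertex e u) c -> 4 < #|S c|.
Proof.
move=> c_strong; rewrite ltnNge; apply/negP => S4.
have [||i] := irreducible (s := enum (nbr e u)) c_strong.
- exact: enum_uniq.
- by move=> x; rewrite mem_enum.
move=> i_s; have vN : nth u (enum (nbr e u)) i \in nbr e u.
  by rewrite -mem_enum mem_nth.
move: i_s; rewrite -cardE [#|_|]du; move: (nth u _ i) vN => v vN i5.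
by have := card_forb1 c_strong vN; lia.
Qed.

(** If i and j share their outer neighbor, their edges to [u] see at most 5 + 5 - 2 old colors each
    and can go last; the other three see at most 9 and go first. *)
Lemma w_inj (c : T -> T -> K) : strong (del_vertex e u) c ->
  {in nbr e u &, injective w}.
Proof.
move=> c_strong i j iN jN wij; apply/eqP/negPn/negP => ij.
have [||k] :=
  irreducible (s := enum (nbr e u :\ i :\ j) ++ [:: i; j]) c_strong.
- by rewrite cat_uniq enum_uniq /= !mem_enum !inE !eqxx ij ?andbF.
- move=> x; rewrite mem_cat mem_enum !inE.
  rewrite !inE in iN jN; have [->|_] := eqVneq x j; first by rewrite jN; case: (j == i).
  by have [->|_] := eqVneq x i; rewrite ?iN ?orbF.
have jN' : j \in nbr e u :\ i by rewrite !inE eq_sym ij; rewrite inE in jN.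
have card3 : #|nbr e u :\ i :\ j| = 3.
  by move: du; rewrite /deg (cardsD1 i) (cardsD1 j) iN jN'; lia.
have S5 := card_S_leq c.
have ij_sub : [set i; j] \subset nbr e u.
  by apply/subsetP => x /set2P[] ->.
have forb_ij v : v \in [set i; j] -> #|forb e c u v| + 2 <= 10.
  move=> vij; have : #|forb e c u v| + #|[set i; j]| <= 5 + #|S c|.
    apply: card_forb_deg5; rewrite // ?(subsetP ij_sub) // => x.
    by move: vij; rewrite !inE => /orP[] /eqP-> /orP[] /eqP->; rewrite // wij.
  by rewrite cards2 ij; lia.
rewrite size_cat nth_cat -cardE card3 => /= k5; case: ifP => [k3|k3].
  have : nth u (enum (nbr e u :\ i :\ j)) k \in nbr e u :\ i :\ j.
    by rewrite -mem_enum mem_nth // -cardE card3.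
  by move=> /setDP[/setDP[vN _] _]; have := card_forb1 c_strong vN; lia.
have [->|->] : k = 3 \/ k = 4 by lia.
  by have := forb_ij i (set21 i j) => /=; lia.
by have := forb_ij j (set22 i j) => /=; lia.
Qed.

(** The colors that the edge from v to [w v] sees once [u] is deleted: v then has no other edge, so
    only the side of [w v] counts. *)
Let R (c : T -> T -> K) v := \bigcup_(x in nbr e (w v) :\ v) colors_at e c u x.

Let new (c : T -> T -> K) v k x y :=
  if (x == v) && (y == w v) || (x == w v) && (y == v) then k else c x y : K.

Lemma recolor_deg5 c v k : strong (del_vertex e u) c -> v \in nbr e u ->
  k \notin R c v -> strong (del_vertex e u) (new c v k).
Proof.
move=> c_strong vN kR; apply: recolor => //.
- by move=> x y; rewrite /del_vertex /= e_sym [(x != u) && _]andbC.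
- by move=> x; rewrite /del_vertex /= e_irr.
move=> x y /and3P[xy xu yu] /orP[] /andP[/and3P[vx _ _] x_new].
  by rewrite (deg5_adj vN vx xu) eqxx in x_new.
apply: contraNneq kR => <-; apply/bigcupP; exists x; first by rewrite !inE x_new.
by apply/imsetP; exists y; rewrite // !inE yu.
Qed.

Lemma card_R c v : v \in nbr e u -> #|R c v| <= 9.
Proof.
move=> vN; have [_ wv] := adj_w vN.
apply: leq_trans (card_bigcup_leq _ _) _.
apply: (@leq_trans (\sum_(x in nbr e (w v) :\ v) deg e x)).
  by apply: leq_sum => x _; apply: colors_at_leq.
apply: leq_trans (pred_mul_leq9 (deg e (w v))).
apply: (nbr_sum_leq wv); first exact: subsetDl.
by rewrite /deg [in leqRHS](cardsD1 v) inE wv.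
Qed.

Lemma deg5_False : False.
Proof.
have [c c_strong] : exists c : T -> T -> K, strong (del_vertex e u) c.
  by apply: e_del; rewrite du.
have [|i [j [k [iN jN ij kRi kRj]]]] :=
    @common_element _ _ (nbr e u) (fun v => ~: R c v).
  (* Each of the five outer edges has at least 13 - 9 = 4 available colors, and 20 > 13. *)
  rewrite cardK; apply: (@leq_trans (\sum_(v in nbr e u) 4)).
    by rewrite sum_nat_const [#|_|]du.
  by apply: leq_sum => v /(card_R c); have := cardsC (R c v); rewrite cardK /=; lia.
rewrite !inE in kRi kRj.
have c1_strong := recolor_deg5 c_strong iN kRi.
have wij : w i != w j by apply: contra_neq ij; apply: (w_inj c_strong).
(* The first recoloring does not block the second: i is not adjacent to [w j], and [w i] and [w j],
   both of degree at least 4, are not adjacent by weight. *)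
have kR1 : k \notin R (new c i k) j.
  apply: contra kRj => /bigcupP[x xN /imsetP[y yN ->]].
  have [_ _ wju dwj] := deg5_nbr jN; have [_ _ _ dwi] := deg5_nbr iN.
  apply/bigcupP; exists x => //; apply/imsetP; exists y => //.
  have wjx : e (w j) x by move: xN; rewrite !inE => /andP[].
  rewrite /new; case: (x =P i) => [xi|_] /=.
    by move: wjx; rewrite xi e_sym => /(deg5_adj iN)/(_ wju)/eqP; rewrite eq_sym (negPf wij).
  by case: (x =P w i) => // xwi; have := e_weight wjx; rewrite xwi; lia.
have := card_S_gt4 (recolor_deg5 c1_strong jN kR1); apply/negP; rewrite -leqNgt.
set c2 := new _ j k.
(* The outer edges of i and j now both have color k, so dropping i loses no color and at most four
   remain. *)
have /subset_leq_card/leq_trans-> // : S c2 \subset [set c2 x (w x) | x in nbr e u :\ i].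
  apply/subsetP => _ /imsetP[x xN ->]; have [->|xi] := eqVneq x i; last first.
    by apply/imsetP; exists x; rewrite // in_setD1 xi.
  apply/imsetP; exists j; first by rewrite in_setD1 eq_sym ij.
  by rewrite /c2 /new !eqxx /= if_same.
apply: leq_trans (leq_imset_card _ _) _.
by move: du; rewrite /deg (cardsD1 i) iN; lia.
Qed.

End Degree5.

Lemma no_deg5 u : deg e u != 5.
Proof. by apply/negP => /eqP/deg5_False. Qed.

(** * Neighborhoods of vertices of degree 2, 3 and 4 *)

Lemma deg2_nbr v a : deg e v = 2 -> e v a -> deg e a = 4.
Proof.
move=> dv va; have := (two_nbr dv va, no_deg5 a).
rewrite e_sym in va; case=> da /eqP; have := deg_lt6 va; lia.
Qed.

Lemma deg_bounds x y : e x y -> 2 <= deg e x <= 4.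
Proof.
move=> xy; have := deg_gt1 xy; have := deg_lt6 xy.
by have /eqP := no_deg5 x; lia.
Qed.

(** Suppose v and v' differ and let b be the other neighbor of v. Then vb sees at most 9 + 3 colors
    and, colored next, va sees at most (2 + 2 * 3) + 3 + 1. *)
Lemma deg4_nbr a v v' : deg e a = 4 -> e a v -> e a v' -> deg e v = 2 ->
  deg e v' = 2 -> v = v'.
Proof.
move=> da av av' dv dv'; apply/eqP/negPn/negP => vv'.
have va : e v a by rewrite e_sym.
have [b [ba vE vaE]] := other_nbr dv va.
have vb : e v b by have := set22 a b; rewrite -vE inE.
have [c c_strong] := e_del (deg_gt0 va).
have [||i] := irreducible (s := [:: b; a]) c_strong.
- by rewrite /= inE ba.
- by move=> x; rewrite vE !inE orbC.
have db := deg2_nbr dv vb.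
have av'v : v' \in nbr e a :\ v by rewrite !inE eq_sym vv'.
have := forb_leq_deg2 c vE ba; rewrite db (bigD1 v') //= dv'.
have : \sum_(x in nbr e a :\ v | x != v') deg e x <= 2 * (7 - deg e a).
  rewrite (eq_bigl (mem (nbr e a :\ v :\ v'))) => [|x]; last by rewrite !inE andbC.
  apply: (nbr_sum_leq av); first by rewrite !(subset_trans (subsetDl _ _)).
  by move: da; rewrite /deg (cardsD1 v) (cardsD1 v') av'v inE av; lia.
have := forb_leq9 c vb; rewrite vE setUC setU1K ?inE // big_set1 da.
by case: i => [|[|i]] /=; lia.
Qed.

Let n4 x := #|[set z in nbr e x | deg e z == 4]|.

Lemma deg3_nbr x z : deg e x = 3 -> e x z -> deg e z = 3 \/ deg e z = 4.
Proof.
move=> dx xz; have zx : e z x by rewrite e_sym.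
have dz2 : deg e z = 2 -> deg e x = 4 by move/deg2_nbr; apply.
by have := deg_bounds zx; lia.
Qed.

(** An edge yx sees at most 6 + n4 x colors around x and 4 around y. If the n4 sum to at most 2,
    coloring the edges by decreasing n4 gives n4 at most 2 - i at position i, hence at most 12
    colors seen. *)
Lemma deg3_far y : deg e y = 3 -> n4 y = 0 -> 3 <= \sum_(x in nbr e y) n4 x.
Proof.
move=> dy /eqP; rewrite cards_eq0 => /eqP n4y.
have d3 x : e y x -> deg e x = 3.
  move=> yx; have [//|dx] := deg3_nbr dy yx.
  by have /setP/(_ x) := n4y; rewrite !inE yx dx.
have [c c_strong] : exists c : T -> T -> K, strong (del_vertex e y) c.
  by apply: e_del; rewrite dy.
have forb_y x : x \in nbr e y -> #|forb e c y x| <= 10 + n4 x.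
  rewrite inE => yx; have xy : e x y by rewrite e_sym.
  apply: leq_trans (forb_leq _ _ _ e_sym) _.
  rewrite [X in _ + X <= _](eq_bigr (fun=> 2)) => [|z]; last first.
    by rewrite !inE => /andP[_ /d3->].
  have cardD (a b : T) : deg e a = 3 -> e a b -> #|nbr e a :\ b| = 2.
    by rewrite /deg (cardsD1 b) inE => + ab; rewrite ab; lia.
  rewrite sum_nat_const cardD //.
  apply: (@leq_trans (\sum_(z in nbr e x :\ y) (3 + (deg e z == 4)) + 2 * 2)).
    rewrite leq_add2r; apply: leq_sum => z; rewrite !inE => /andP[_ xz].
    by case: (deg3_nbr (d3 _ yx) xz) => ->.
  rewrite big_split /= sum_nat_const cardD ?d3 //.
  suff : \sum_(z in nbr e x :\ y) (deg e z == 4) <= n4 x by lia.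
  rewrite -big_mkcondr sum1dep_card; apply/subset_leq_card/subsetP => z.
  by rewrite !inE -andbA => /andP[].
rewrite ltnNge; apply/negP => n4_sum.
have [s s_perm s_sorted] : exists2 s, perm_eq s (enum (nbr e y))
    & sorted (fun x z => n4 z <= n4 x) s.
  exists (sort (fun x z => n4 z <= n4 x) (enum (nbr e y))).
    by rewrite perm_sort.
  by apply: sort_sorted => a b; apply: leq_total.
have [||i i_s] := irreducible (s := s) c_strong.
- by rewrite (perm_uniq s_perm) enum_uniq.
- by move=> x; rewrite (perm_mem s_perm) mem_enum.
have := forb_y (nth y s i); rewrite -mem_enum -(perm_mem s_perm) mem_nth // => /(_ isT).
have s3 : size s = 3 by rewrite (perm_size s_perm) -cardE.
move: n4_sum; rewrite -big_enum -(perm_big _ s_perm) /=.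
case: s s3 s_sorted i_s {s_perm} => [|x0 [|x1 [|x2 [|x3 s]]]] //= _.
rewrite !big_cons big_nil => /and3P[le10 le21 _].
by case: i => [|[|[|i]]] //=; lia.
Qed.

(** * Discharging *)

(* Charges are scaled by 39: a vertex of degree d starts with 39 d - 120. *)
Let sent x z :=
  if deg e x == 4 then if deg e z == 2 then 21 else 5
  else if (deg e x == 3) && (deg e z == 3) then n4 x else 0.

(** Degree 2: 78 + 2 * 21 = 120. Degree 3 with n 4-neighbors: the net gain is at least 5n - (3 - n)n
    >= 3 if n > 0, and [deg3_far] gives 3 if n = 0. Degree 4: 156 = 120 + 4 * 5 + 16, the 16 being
    the surplus for one 2-neighbor. *)
Lemma charge_ge0 v : 0 < deg e v ->
  120 + \sum_(z in nbr e v) sent v z <= 39 * deg e v + \sum_(z in nbr e v) sent z v.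
Proof.
move=> /card_gt0P[x]; rewrite inE => /deg_bounds dv.
have [dv2|[dv3|dv4]] : deg e v = 2 \/ deg e v = 3 \/ deg e v = 4 by lia.
- rewrite big1 => [|z _]; last by rewrite /sent dv2.
  rewrite [X in _ <= _ + X](eq_bigr (fun=> 21)) => [|z]; last first.
    by rewrite inE => vz; rewrite /sent (deg2_nbr dv2 vz) dv2.
  by rewrite sum_nat_const [#|_|]dv2 dv2.
- have [n0|n_gt0] := posnP (n4 v).
    rewrite big1 => [|z _]; last by rewrite /sent dv3 n0 if_same.
    rewrite [X in _ <= _ + X](eq_bigr n4) => [|z]; last first.
      rewrite inE => vz; rewrite /sent dv3.
      have [-> //|dz] := deg3_nbr dv3 vz.
      by have := card0_eq n0 z; rewrite !inE vz dz.
    by have := deg3_far dv3 n0; lia.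
  have n4E : n4 v = \sum_(z in nbr e v) (deg e z == 4).
    by rewrite -big_mkcondr sum1dep_card; apply: eq_card => z; rewrite !inE.
  have n3E : 3 = \sum_(z in nbr e v) (deg e z == 3) + n4 v.
    rewrite n4E -big_split -[LHS]dv3 -[LHS]sum1_card; apply: eq_bigr => z.
    by rewrite inE => /(deg3_nbr dv3)[->|->].
  have -> : \sum_(z in nbr e v) sent v z = (\sum_(z in nbr e v) (deg e z == 3)) * n4 v.
    rewrite big_distrl; apply: eq_bigr => z _; rewrite /sent dv3 /=.
    by case: eqP; rewrite ?mul1n ?mul0n.
  have : n4 v * 5 <= \sum_(z in nbr e v) sent z v.
    rewrite [X in X * _]n4E big_distrl; apply: leq_sum => z _.
    by rewrite /sent dv3; case: eqP.
  move: (\sum_(z in _) (_ == 3)) (\sum_(z in _) sent _ _) (n4 v) n3E n_gt0 => m r n.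
  rewrite dv3 => mn n_gt0; have [m0|[m1|m2]] : m = 0 \/ m = 1 \/ m = 2 by lia.
  - by subst m; lia.
  - by subst m; lia.
  - by subst m; lia.
rewrite (eq_bigr (fun z => 5 + (deg e z == 2) * 16)) => [|z _]; last first.
  by rewrite /sent dv4 /=; case: eqP.
rewrite big_split /= sum_nat_const [#|_|]dv4 -big_distrl /= dv4.
suff : \sum_(z in nbr e v) (deg e z == 2) <= 1 by lia.
rewrite -big_mkcondr sum1dep_card; apply/card_le1_eqP => a b; rewrite !inE.
by move=> /andP[va /eqP da] /andP[vb /eqP db]; apply: (deg4_nbr dv4).
Qed.

(** Summed over the non-isolated vertices, the charges sent and received cancel; dividing by 3
    undoes part of the scaling. *)
Lemma critical_dense :
  40 * #|[set v | 0 < deg e v]| <= 13 * \sum_(v | 0 < deg e v) deg e v.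
Proof.
have : \sum_(v | 0 < deg e v) (120 + \sum_(z in nbr e v) sent v z) <=
    \sum_(v | 0 < deg e v) (39 * deg e v + \sum_(z in nbr e v) sent z v).
  by apply: leq_sum => v; apply: charge_ge0.
rewrite 2!big_split /= sum_nat_cond_const -big_distrr /=.
rewrite [X in _ <= _ + X](exchange_big_dep (fun v => 0 < deg e v)) /=; last first.
  by move=> v z _; rewrite inE e_sym => /deg_gt0.
rewrite [X in _ <= _ + X](eq_bigr (fun v => \sum_(z in nbr e v) sent v z)).
  by rewrite leq_add2r; lia.
move=> v v_gt0; apply: eq_bigl => z; rewrite !inE [e z v]e_sym andb_idl //.
by rewrite e_sym => /deg_gt0.
Qed.

End Critical.

(** * Existence of a minimal counterexample *)

Lemma deg_sub (T : finType) (e e' : rel T) x : subrel e e' -> deg e x <= deg e' x.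
Proof.
by move=> ee'; apply/subset_leq_card/subsetP => y; rewrite !inE => /ee'.
Qed.

(** Induction on the number of adjacent ordered pairs: the weight bound and the sparsity of all
    induced subgraphs survive deleting a vertex. *)
Lemma sparse_strong (T K : finType) (e : rel T) : #|K| = 13 ->
    symmetric e -> irreflexive e ->
    (forall x y, e x y -> deg e x + deg e y <= 7) ->
    (forall X : {set T}, X != set0 ->
      13 * \sum_(x in X) #|nbr e x :&: X| < 40 * #|X|) ->
  exists c : T -> T -> K, strong e c.
Proof.
move=> cardK; have [n] := ubnP #|[set p | e p.1 p.2]|.
elim: n e => // n IHn e /ltnSE-le_n e_sym e_irr e_weight e_sparse.
apply: NNPP => e_ncol.
have e_del v : 0 < deg e v -> exists c : T -> T -> K, strong (del_vertex e v) c.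
  move=> /card_gt0P[u]; rewrite inE => vu.
  have del_sub : subrel (del_vertex e v) e by move=> x y /andP[].
  apply: IHn.
  - apply: leq_trans le_n; apply/proper_card/properP; split.
      by apply/subsetP=> p; rewrite !inE => /del_sub.
    by exists (v, u); rewrite !inE ?vu //= /del_vertex /= eqxx andbF.
  - by move=> x y; rewrite /del_vertex /= e_sym [(x != v) && _]andbC.
  - by move=> x; rewrite /del_vertex /= e_irr.
  - move=> x y /del_sub /e_weight; apply: leq_trans.
    by rewrite leq_add // deg_sub.
  move=> X /e_sparse; apply: leq_ltn_trans; rewrite leq_mul2l; apply: leq_sum => x _.
  by apply/subset_leq_card/setSI/subsetP => y; rewrite !inE => /del_sub.
have := critical_dense cardK e_sym e_irr e_weight e_del e_ncol.
(* Sparsity is applied to the non-isolated vertices only, where inner degrees are full degrees. If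
   there are none, any constant coloring is strong. *)
set X := [set v | _]; have X0 : X != set0.
  apply/negP => /eqP X0; case: e_ncol.
  have eF x y : e x y = false.
    by apply/negP => /(deg_gt0 (e := e)); have /setP/(_ x) := X0; rewrite !inE => ->.
  have /card_gt0P[k _] : 0 < #|K| by rewrite cardK.
  by exists (fun _ _ => k); split=> [x y|x y z|x y z w]; rewrite ?eF.
have := e_sparse X X0.
rewrite (eq_bigr (deg e)) => [|x xX]; last first.
  congr #|pred_of_set _|; apply/setIidPl/subsetP => y; rewrite !inE e_sym.
  exact: deg_gt0.
rewrite (eq_bigl (fun v => 0 < deg e v)) => [|v]; last by rewrite inE.
by lia.
Qed.

(** * Transfer to graphs, maximum average degree and line graph distance *)

Section Main.

Variable G : sgraph.

(** Ordered adjacent pairs (x, y) inject into incidences of x with the edge {x, y}, and an edge has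
    at most two ends. *)
Lemma card_arcs_leq (X : {set G}) :
  \sum_(x in X) #|nbr (@adj G) x :&: X| <= 2 * #|[set f in edges G | f \subset X]|.
Proof.
set F := [set f in _ | _].
apply: (@leq_trans (\sum_(x in X) \sum_(f in F | x \in f) 1)).
  apply: leq_sum => x xX; rewrite sum1dep_card.
  have inj : {in nbr (@adj G) x :&: X &, injective (fun y => [set x; y])}.
    move=> y z; rewrite !inE => /andP[xy _] _ yz.
    have := set22 x y; rewrite yz => /set2P[yx|//].
    by rewrite yx adj_irr in xy.
  rewrite -(card_in_imset inj); apply/subset_leq_card/subsetP => _ /imsetP[y + ->].
  rewrite !inE => /andP[xy yX]; rewrite eqxx andbT; apply/andP; split.
    by apply/imsetP; exists (x, y); rewrite ?inE.
  by apply/subsetP => z /set2P[]->.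
rewrite (exchange_big_dep (mem F)) /= => [|x f _ /andP[]//].
rewrite mulnC -sum_nat_const; apply: leq_sum => f.
rewrite inE => /andP[/imsetP[[x y] _ ->] _].
rewrite sum1dep_card; apply: (@leq_trans #|[set x; y]|).
  by apply/subset_leq_card/subsetP => z; rewrite inE => /and3P[].
by rewrite cards2; case: (_ != _).
Qed.

Lemma mad_sparse (X : {set G}) : (mad G < 40%:R / 13%:R)%R -> X != set0 ->
  13 * \sum_(x in X) #|nbr (@adj G) x :&: X| < 40 * #|X|.
Proof.
move=> madG X0; pose H := (X, [set f in edges G | f \subset X]).
have H_sub : is_subgraph H && (H.1 != set0).
  rewrite X0 andbT; apply/andP; split.
    by apply/subsetP => f; rewrite inE => /andP[].
  by apply/forall_inP => f; rewrite inE => /andP[].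
have : (avg_degree H < 40%:R / 13%:R)%R.
  by apply: Order.POrderTheory.le_lt_trans madG; apply: Order.TotalTheory.le_bigmax_cond.
rewrite /avg_degree Num.Theory.ltr_pdivrMr ?Num.Theory.ltr0n ?card_gt0 //.
rewrite GRing.mulrAC Num.Theory.ltr_pdivlMr ?Num.Theory.ltr0n //.
rewrite -!GRing.natrM Num.Theory.ltr_nat /=.
by apply: leq_ltn_trans; rewrite mulnC leq_mul2r card_arcs_leq orbT.
Qed.

(** A walk of length one gives a common end. In one of length two, the middle edge meets f in x and
    g in y, which are thus equal or its two ends. *)
Lemma line_dist2 (f g : edge G) : f != g -> @dist_at_most (line_graph G) 2 f g ->
  exists x y, [/\ x \in val f, y \in val g & (x == y) || adj x y].
Proof.
move=> fg; rewrite /dist_at_most; case dE : dist => [k|//] k2.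
have : @walk (line_graph G) k f g.
  have : k \in [seq k <- iota 0 #|line_graph G| | @walk (line_graph G) k f g].
    by move: dE; rewrite /dist; case: filter => //= ? ? [->]; rewrite mem_head.
  by rewrite mem_filter => /andP[].
case: k {dE} k2 => [|[|[|//]]] _ /existsP[].
- by move=> p; rewrite tuple0 /= (negPf fg).
- case/tupleP=> h p; rewrite tuple0 /= andbT => /andP[/andP[_ /set0Pn[x xfh]] /eqP <-].
  by move: xfh; rewrite inE => /andP[xf xh]; exists x, x; rewrite eqxx.
case/tupleP=> h /tupleP[h' p]; rewrite tuple0 /= andbT.
move=> /andP[/andP[/andP[_ /set0Pn[x xfh]] /andP[_ /set0Pn[y yhg]]] /eqP <-].
move: xfh yhg; rewrite !inE => /andP[xf xh] /andP[yh yg]; exists x, y; split=> //.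
move: xh yh; have /imsetP[[a b] ab ->] := valP h; rewrite inE /= in ab.
move=> /set2P[]-> /set2P[]->; rewrite ?eqxx ?ab ?orbT //.
by rewrite adj_sym ab orbT.
Qed.

Lemma strong_colorable (c : G -> G -> 'I_13) :
  strong (@adj G) c -> strong_edge_colorable G 13.
Proof.
move=> [c_sym c_prop c_dist].
(* Symmetry of [c] makes the choice of the pair harmless, and every edge has such a pair, so [ord0]
   is never the value. *)
pose col (f : edge G) :=
  if [pick p : G * G | adj p.1 p.2 && (val f == [set p.1; p.2])] is Some p
  then c p.1 p.2 else ord0.
have colE (f : edge G) x : x \in val f ->
    exists y, [/\ adj x y, val f = [set x; y] & col f = c x y].
  rewrite /col; case: pickP => [[a b] /= /andP[ab /eqP->] /set2P[]->|noab].
  - by exists b.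
  - by exists a; rewrite adj_sym c_sym setUC.
  have /imsetP[[a b] ab fE] := valP f.
  by have := noab (a, b); rewrite /= fE eqxx andbT; rewrite inE /= in ab; rewrite ab.
have col_meet (f g : edge G) x : f != g -> x \in val f -> x \in val g -> col f != col g.
  move=> fg /colE[y [xy fE ->]] /colE[z [xz gE ->]]; apply: c_prop => //.
  by apply: contra_neq fg => yz; apply: val_inj; rewrite /= fE gE yz.
apply/existsP; exists [ffun f => col f].
apply/forallP=> f; apply/forallP=> g; apply/implyP=> /andP[fg /(line_dist2 fg)].
case=> x [z [xf zg /orP[/eqP xz|xz]]]; rewrite !ffunE.
  by apply: (col_meet _ _ x); rewrite // xz.
have [y [xy fE fc]] := colE _ _ xf; have [w [zw gE gc]] := colE _ _ zg.
(* The third clause of [strong] needs a nonbacktracking walk; in the two degenerate cases the edges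
   share an end. *)
have [yz|yz] := eqVneq y z; first by apply: (col_meet _ _ z); rewrite // fE yz set22.
have [xw|xw] := eqVneq x w; first by apply: (col_meet _ _ x); rewrite // gE xw set22.
by rewrite fc gc; apply: c_dist.
Qed.

End Main.

Theorem theorem1p3 (G : sgraph) (Gconn : connected G)
    (GW : max_edge_weight G <= 7) (Gmad : (mad G < 40%:R / 13%:R)%R) :
  strong_chromatic_index G <= 13.
Proof.
have [||x y xy||c /strong_colorable col] := @sparse_strong G _ (@adj G) (card_ord 13).
- exact: adj_sym.
- exact: adj_irr.
- apply: leq_trans GW; rewrite -[deg _ x]/(degree x) -[deg _ y]/(degree y).
  exact: (bigmax_sup (x, y)).
- by move=> X; apply: mad_sparse.
by rewrite /strong_chromatic_index; case: ex_minnP => k _; apply.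
Qed.
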